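(* Let $\mathcal{D}$ be a nonempty finite set, and let $M, I : \mathcal{D} \to \mathbb{R}$ be functions with $M(\mathbf{x}) \ge 0$ and $I(\mathbf{x}) > 0$ for all $\mathbf{x} \in \mathcal{D}$. Put $$F(\mathbf{x}) = \frac{M(\mathbf{x})}{I(\mathbf{x})}, \qquad \mathcal{R} = \Big\{ \frac{M(\mathbf{x})}{I(\mathbf{x})} : \mathbf{x} \in \mathcal{D} \Big\}, \qquad \lambda^\star = \max \mathcal{R}.$$ Then the Dinkelbach algorithm applied to $\max_{\mathbf{x} \in \mathcal{D}} F(\mathbf{x})$, with each subproblem solved exactly, terminates in a finite number of iterations and returns a globally optimal pair $(\mathbf{x}^\star, \lambda^\star)$ with $\mathbf{x}^\star \in \mathcal{D}$ and $F(\mathbf{x}^\star) = \lambda^\star$. Moreover, if $|\mathcal{R}| = r$, at most $r$ iterations are required.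
   Context: For $\lambda \in \mathbb{R}$ let $\Phi(\lambda) = \max_{\mathbf{x} \in \mathcal{D}} \{ M(\mathbf{x}) - \lambda I(\mathbf{x}) \}$. The Dinkelbach algorithm (in exact arithmetic) is the following procedure. Initialize $k = 0$ and $\lambda_0 = 0$. At stage $k$, solve the subproblem exactly, i.e. choose any $$\mathbf{x}_k \in \arg\max_{\mathbf{x} \in \mathcal{D}} \{ M(\mathbf{x}) - \lambda_k I(\mathbf{x}) \}.$$ If $\Phi(\lambda_k) = 0$, stop and return the pair $(\mathbf{x}_k, \lambda_k)$. Otherwise set $\lambda_{k+1} = M(\mathbf{x}_k)/I(\mathbf{x}_k)$, replace $k$ by $k+1$ and repeat. The number of iterations is the number of updates $\lambda_k \mapsto \lambda_{k+1}$ performed before the algorithm stops. *)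

(* Defs.v *)
From Stdlib Require Import Relation_Operators.
From mathcomp Require Import all_boot all_order all_algebra finmap reals.

Set Implicit Arguments.
Unset Strict Implicit.
Unset Printing Implicit Defensive.

Import Order.TTheory GRing.Theory Num.Theory.
Local Open Scope fset_scope.
Local Open Scope ring_scope.

(* The seed of the iterated maximum is an element of A whenever A is nonempty,
   so fmax A is then the maximum of A (see fmaxP); fmax fset0 = 0 is junk. *)
Definition fmax (R : realType) (A : {fset R}) : R :=
  \big[Num.max/head 0 A]_(y <- A) y.

Lemma fmaxP (R : realType) (A : {fset R}) :
  A != fset0 -> fmax A \in A /\ (forall y, y \in A -> y <= fmax A).
Proof.
move=> A0; split; last by move=> y yA; exact: (le_bigmax_seq _ _ xpredT id yA).
rewrite /fmax big_seq; apply: (big_ind (fun z => z \in A)) => [|x y xA yA|//].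
  have : size A != 0%N by rewrite cardfs_eq0.
  have : {subset (A : seq R) <= A} by [].
  by case: (A : seq R) => // a s sA _; apply: sA; rewrite mem_head.
by case: (leP x y).
Qed.

Section Dinkelbach.
Variables (R : realType) (D : finType) (M I : D -> R).

Definition frac_obj (x : D) : R := M x / I x.

Definition frac_values : {fset R} := [fset frac_obj x | x : D].

Definition param_obj (lambda : R) (x : D) : R := M x - lambda * I x.

Definition Phi (lambda : R) : R := fmax [fset param_obj lambda x | x : D].

Definition argmax (lambda : R) : {set D} :=
  [set x | [forall y, param_obj lambda y <= param_obj lambda x]].

(* [Stage k lambda]: about to solve the subproblem of stage k with
   lambda_k = lambda.  [Returned k x lambda]: stopped at stage k with output
   (x, lambda).  In both cases exactly k updates have been performed. *)
Inductive state : Type :=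
| Stage of nat & R
| Returned of nat & D & R.

Definition iterations (s : state) : nat :=
  match s with Stage k _ => k | Returned k _ _ => k end.

Definition init : state := Stage 0 0.

(* Nondeterministic: any maximiser of the subproblem may be chosen. *)
Inductive step : state -> state -> Prop :=
| step_stop k lambda x :
    x \in argmax lambda -> Phi lambda = 0 ->
    step (Stage k lambda) (Returned k x lambda)
| step_update k lambda x :
    x \in argmax lambda -> Phi lambda <> 0 ->
    step (Stage k lambda) (Stage k.+1 (M x / I x)).

Definition reachable (s : state) : Prop := clos_refl_trans _ step init s.

Definition halted (s : state) : Prop := forall s', ~ step s s'.

(* Accessibility for the converse of [step]: every run is finite. *)
Definition terminates : Prop := Acc (fun s' s => step s s') init.

End Dinkelbach.

(* Main.v *)
(* As long as lambda <= lambda^*, Phi lambda >= 0.  If Phi lambda = 0, then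
   lambda = lambda^* and every maximiser x of the subproblem satisfies
   F x = lambda.  If Phi lambda > 0, then lambda < F x <= lambda^*, so the number
   of ratios exceeding the current lambda strictly decreases at each update;
   this number is initially at most r. *)

Require Import Defs.
From Stdlib Require Import Relation_Operators.
From mathcomp Require Import all_boot all_order all_algebra finmap reals.

Set Implicit Arguments.
Unset Strict Implicit.
Unset Printing Implicit Defensive.

Import Order.TTheory GRing.Theory Num.Theory.
Local Open Scope fset_scope.
Local Open Scope ring_scope.

Lemma fmax_image_ge (R : realType) (D : finType) (f : D -> R) (x : D) :
  f x <= fmax [fset f y | y : D].
Proof.
have fx : f x \in [fset f y | y : D] by apply/imfsetP; exists x.
have A0 : [fset f y | y : D] != fset0 by apply/fset0Pn; exists (f x).
by case: (fmaxP A0) => _; apply.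
Qed.

Lemma fmax_image_attained (R : realType) (D : finType) (f : D -> R) (x0 : D) :
  exists x, fmax [fset f y | y : D] = f x.
Proof.
have A0 : [fset f y | y : D] != fset0.
  by apply/fset0Pn; exists (f x0); apply/imfsetP; exists x0.
by case: (fmaxP A0) => /imfsetP[x _ ->] _; exists x.
Qed.

Lemma fmax_image_eq (R : realType) (D : finType) (f : D -> R) (x : D) :
  (forall y, f y <= f x) -> fmax [fset f y | y : D] = f x.
Proof.
move=> max_x; apply/eqP; rewrite eq_le fmax_image_ge andbT.
by have [y ->] := fmax_image_attained f x.
Qed.

Section DinkelbachRun.
Variables (R : realType) (D : finType) (M I : D -> R).
Hypothesis I_gt0 : forall x, 0 < I x.

Local Notation F := (frac_obj M I).
Local Notation max_ratio := (fmax (frac_values M I)).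

Definition ratios_above (lambda : R) : {fset R} :=
  [fset v in frac_values M I | lambda < v].

Lemma argmax_exists (x0 : D) (lambda : R) : exists x, x \in argmax M I lambda.
Proof.
exists [arg max_(y > x0) param_obj M I lambda y]%O.
rewrite inE; apply/forallP => y.
by case: arg_maxP => // x _; apply.
Qed.

Lemma Phi_argmax (lambda : R) (x : D) :
  x \in argmax M I lambda -> Phi M I lambda = param_obj M I lambda x.
Proof. by rewrite inE => /forallP; exact: fmax_image_eq. Qed.

Lemma param_obj_ge0 (lambda : R) (x : D) :
  (0 <= param_obj M I lambda x) = (lambda <= F x).
Proof. by rewrite subr_ge0 ler_pdivlMr. Qed.

Lemma param_obj_le0 (lambda : R) (x : D) :
  (param_obj M I lambda x <= 0) = (F x <= lambda).
Proof. by rewrite subr_le0 ler_pdivrMr. Qed.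

(** A point attaining the maximal ratio already has nonnegative parametric objective. [x0] only
    witnesses that [D] is inhabited. *)
Lemma Phi_ge0 (x0 : D) (lambda : R) :
  lambda <= max_ratio -> 0 <= Phi M I lambda.
Proof.
have [x ->] := fmax_image_attained F x0; rewrite -param_obj_ge0.
by move=> /le_trans; apply; exact: fmax_image_ge.
Qed.

Lemma argmax_Phi0 (lambda : R) (x : D) :
    x \in argmax M I lambda -> Phi M I lambda = 0 ->
  lambda = max_ratio /\ F x = lambda.
Proof.
move=> x_max; rewrite (Phi_argmax x_max) => px0.
have Fx : F x = lambda.
  by apply/eqP; rewrite eq_le -param_obj_le0 -param_obj_ge0 px0 lexx.
split=> //; rewrite -Fx; apply/esym/fmax_image_eq => y.
by rewrite Fx -param_obj_le0 -px0; move: x_max; rewrite inE => /forallP.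
Qed.

Lemma argmax_Phi_neq0 (lambda : R) (x : D) :
    lambda <= max_ratio -> x \in argmax M I lambda -> Phi M I lambda <> 0 ->
  lambda < F x.
Proof.
move=> /(Phi_ge0 x) + x_max; rewrite (Phi_argmax x_max) => px_ge0 px0.
by rewrite ltNge -param_obj_le0; apply/negP => px_le0; apply/px0/le_anti/andP.
Qed.

(** The value [F x] itself is lost: it exceeds [lambda], but not itself. *)
Lemma ratios_above_decr (lambda : R) (x : D) :
  lambda < F x -> (#|` ratios_above (F x)| < #|` ratios_above lambda|)%N.
Proof.
move=> lt_lx; apply: fproper_ltn_card; rewrite fproperE.
apply/andP; split.
  by apply/fsubsetP => v; rewrite !inE => /andP[-> /(lt_trans lt_lx)].
apply/fsubsetPn; exists (F x); rewrite !inE ?ltxx ?andbF // lt_lx andbT.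
by apply/imfsetP; exists x.
Qed.

(** The count of larger ratios serves as a budget of remaining updates: each update adds one to [k]
    and uses up at least one unit. The bound by [max_ratio] is what keeps [Phi] nonnegative. *)
Definition run_invariant (s : state R D) : Prop :=
  match s with
  | Stage k lambda =>
      lambda <= max_ratio /\
      (k + #|` ratios_above lambda| <= #|` frac_values M I|)%N
  | Returned k x lambda =>
      [/\ (k <= #|` frac_values M I|)%N, lambda = max_ratio & F x = lambda]
  end.

Lemma run_invariant_step (s s' : state R D) :
  step M I s s' -> run_invariant s -> run_invariant s'.
Proof.
case=> k lambda x x_max Phi_l /= [le_l le_k].
  have [l_max Fx] := argmax_Phi0 x_max Phi_l.
  by split=> //; apply: leq_trans le_k; exact: leq_addr.
split; first exact: fmax_image_ge.
apply: leq_trans le_k; rewrite addSnnS leq_add2l.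
exact/ratios_above_decr/argmax_Phi_neq0.
Qed.

Lemma run_invariant_reachable (s : state R D) :
  run_invariant (init R D) -> reachable M I s -> run_invariant s.
Proof.
(* The invariant of the start state stays in the goal, so that the induction covers arbitrary start
   states, as transitivity requires. *)
rewrite /reachable => + run; elim: run => [? ?|//|? ? ? _ IH1 _ IH2 /IH1/IH2//].
exact: run_invariant_step.
Qed.

(** Induction on a strict bound for the number of ratios above [lambda]; [k] is generalised because
    it grows along the run. *)
Lemma Acc_Stage (k : nat) (lambda : R) :
  lambda <= max_ratio -> Acc (fun s' s => step M I s s') (Stage D k lambda).
Proof.
have [n] := ubnP #|` ratios_above lambda|.
elim: n k lambda => [|n IHn] k lambda; first by rewrite ltn0.
rewrite ltnS => le_n le_l.
constructor=> s' run; move Es: (Stage D k lambda) run => s run.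
case: run Es => k' l' x x_max Phi_l [_ El]; subst l'.
  (* After a stop, no constructor of [step] starts from a [Returned] state. *)
  by constructor=> s'' run; inversion run.
apply: IHn; last exact: fmax_image_ge.
by apply: leq_trans le_n; exact/ratios_above_decr/argmax_Phi_neq0.
Qed.

(** A maximiser always exists, and it enables one of the two rules according to whether [Phi]
    vanishes. Hence a run can only end in a [Returned] state. *)
Lemma Stage_not_halted (x0 : D) (k : nat) (lambda : R) :
  ~ halted M I (Stage D k lambda).
Proof.
have [x x_max] := argmax_exists x0 lambda.
by have [Phi0|/eqP Phi0] := eqVneq (Phi M I lambda) 0;
   move=> halt; apply: halt; [apply: step_stop x_max _|apply: step_update x_max _].
Qed.

End DinkelbachRun.

Theorem corollaryA2 (R : realType) (D : finType) (M I : D -> R)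
    (D_nonempty : (0 < #|D|)%N)
    (M_ge0 : forall x, 0 <= M x)
    (I_gt0 : forall x, 0 < I x) :
  [/\ terminates M I,
      (forall s, reachable M I s -> halted M I s ->
         exists k (xstar : D) (lambdastar : R),
           [/\ s = Returned k xstar lambdastar,
               lambdastar = fmax (frac_values M I) &
               frac_obj M I xstar = lambdastar])
    & (forall r : nat, #|` frac_values M I| = r ->
         forall s, reachable M I s -> (iterations s <= r)%N)].
Proof.
have [x0 _] := card_gt0P D_nonempty.
(* Nonnegativity of [M] makes the initial parameter 0 a lower bound for the maximal ratio. *)
have max_ge0 : 0 <= fmax (frac_values M I).
  apply: le_trans (fmax_image_ge (frac_obj M I) x0).
  by rewrite divr_ge0 // ltW.
have inv s : reachable M I s -> run_invariant M I s.
  apply: run_invariant_reachable => //; split=> //.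
  (* With [k = 0], the budget is at most the number of all ratios. *)
  by apply: fsubset_leq_card; apply/fsubsetP => v; rewrite !inE => /andP[].
split; first exact: Acc_Stage.
  move=> [k l|k x l] /inv /= run_inv halt.
    by case: (Stage_not_halted x0 halt).
  by case: run_inv => _ l_max Fx; exists k, x, l.
move=> r <- [k l|k x l] /inv /=; last by case.
by case=> _; apply: leq_trans; exact: leq_addr.
Qed.
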